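(* Let $G$ be a multigraph of order at least $2$. Then there is a multigraph $H$, obtained from $G$ by adding a new edge between a pair of distinct (possibly already adjacent) vertices of $G$, such that $\mu(H)>\mu(G)$.
   Context: Multigraphs are finite, loopless, and may contain multiple (parallel) edges, which are distinguished from one another; they need not be connected. The order of a multigraph is its number of vertices. A subtree of a multigraph $G$ is a (not necessarily induced) subgraph of $G$ that is a tree; subtrees using different parallel edges are different subtrees. The null graph (with no vertices) is not counted as a subtree, while single vertices are. Let $\mathcal{T}_G$ be the set of subtrees of $G$ and $S_G(x)=\sum_{T\in\mathcal{T}_G}x^{|V(T)|}$. The mean subtree order of $G$ is the average order of a subtree of $G$, that is, $\mu(G)=S_G'(1)/S_G(1)$. *)

(* Defs.v *)
From HB Require Import structures.
From mathcomp Require Import all_boot all_order all_algebra.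
Set Implicit Arguments.
Unset Strict Implicit.
Unset Printing Implicit Defensive.
Import Order.TTheory GRing.Theory Num.Theory.
Local Open Scope ring_scope.

(* Edges form their own type, so parallel edges are distinguished;
   [ends_card] excludes loops. *)
Record multigraph := Multigraph {
  vertex : finType;
  edge : finType;
  ends : edge -> {set vertex};
  ends_card : forall e, #|ends e| = 2
}.

Section Subtrees.

Variable G : multigraph.

(* A subgraph is encoded as a pair (vertex set, edge set). *)
Definition is_subgraph (A : {set vertex G}) (B : {set edge G}) : bool :=
  [forall e in B, ends e \subset A].

Definition adj (B : {set edge G}) : rel (vertex G) :=
  [rel x y | [exists e in B, ends e == [set x; y]]].

(* For a subgraph (A, B), walks along edges of B starting in A stay in A. *)
Definition is_connected (A : {set vertex G}) (B : {set edge G}) : bool :=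
  [forall x in A, forall y in A, connect (adj B) x y].

(* The cycle v_0 e_0 v_1 e_1 ... v_(k-1) e_(k-1) v_0 with all v_i distinct,
   all e_i distinct and in B, and e_i joining v_i to v_(i+1 mod k). Two
   parallel edges form a cycle with k = 2; k = 1 would require a loop. *)
Definition is_cycle (B : {set edge G}) (vs : seq (vertex G))
    (es : seq (edge G)) : bool :=
  [&& (0 < size vs)%N, uniq vs, uniq es, all (mem B) es
    & map (@ends G) es == [seq [set p.1; p.2] | p <- zip vs (rot 1 vs)]].

(* Bounding the length k by the number of vertices only serves to make the
   predicate boolean: see [is_acyclicP]. *)
Definition is_acyclic (B : {set edge G}) : bool :=
  ~~ [exists k : 'I_(#|vertex G|).+1, exists vs : k.-tuple (vertex G),
      exists es : k.-tuple (edge G), is_cycle B vs es].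

Lemma is_acyclicP (B : {set edge G}) :
  reflect (forall vs es, ~~ is_cycle B vs es) (is_acyclic B).
Proof.
apply: (iffP idP) => [acB vs es | acB]; last first.
  by apply/existsP => -[k /existsP[vs /existsP[es]]]; apply/negP/acB.
apply: contra acB => cyc; have /and5P[_ uvs _ _ /eqP eqe] := cyc.
have size_es : size es == size vs.
  by rewrite -(size_map (@ends G)) eqe size_map size_zip size_rot minnn.
have vs_lt : (size vs < #|vertex G|.+1)%N.
  by rewrite ltnS -(card_uniqP uvs) max_card.
apply/existsP; exists (Ordinal vs_lt); apply/existsP; exists (in_tuple vs).
by apply/existsP; exists (Tuple size_es).
Qed.

Definition is_tree (A : {set vertex G}) (B : {set edge G}) : bool :=
  [&& A != set0, is_connected A B & is_acyclic B].

Definition subtrees : {set {set vertex G} * {set edge G}} :=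
  [set T | is_subgraph T.1 T.2 && is_tree T.1 T.2].

Definition subtree_poly : {poly rat} := \sum_(T in subtrees) 'X^#|T.1|.

Definition mean_subtree_order : rat :=
  subtree_poly^`().[1] / subtree_poly.[1].

End Subtrees.

Lemma add_edge_card (G : multigraph) (u v : vertex G) (neq_uv : u != v)
  (e : option (edge G)) : #|oapp (@ends G) [set u; v] e| = 2.
Proof. by case: e => [e|] /=; [exact: ends_card | rewrite cards2 neq_uv]. Qed.

(* The new edge is [None]; the edges of [G] are kept as [Some e]. *)
Definition add_edge (G : multigraph) (u v : vertex G) (neq_uv : u != v) :
    multigraph :=
  Multigraph (add_edge_card neq_uv).

(* Main.v *)
Require Import Defs.
From mathcomp Require Import all_boot all_order all_algebra.
From mathcomp Require Import ring.
Set Implicit Arguments.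
Unset Strict Implicit.
Unset Printing Implicit Defensive.
Import Order.TTheory GRing.Theory Num.Theory.
Local Open Scope ring_scope.

(* If f is an edge of G joining u and v, then the subtrees of G + uv that use
   the new edge correspond to the subtrees of G that contain f.  It thus
   suffices to find f such that the subtrees containing f have mean order
   larger than mu = mu(G).  A subtree of order n has n - 1 edges, so summing
   |T| - mu over all pairs (f, T) with f in T gives the sum over T of
   (|T| - 1)(|T| - mu), which equals the sum of (|T| - mu)^2 and is therefore
   positive.  If G has no edges, then mu = 1 and any new edge works. *)

(** * Paths, cycles and edge deletion in forests; the edge count of a tree *)

Section Forests.

Variable G : multigraph.
Implicit Types (A R : {set vertex G}) (B : {set edge G}).

Lemma adj_sym B : symmetric (adj B).
Proof. by move=> x y; rewrite /adj /= setUC. Qed.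

Lemma connect_adj_sym B : connect_sym (adj B).
Proof. exact/sym_connect_sym/adj_sym. Qed.

Lemma ends_adj B e x y : e \in B -> ends e = [set x; y] -> adj B x y.
Proof. by move=> eB /eqP exy; apply/existsP; exists e; rewrite eB. Qed.

Lemma connect_adjS B B' x y :
  B \subset B' -> connect (adj B) x y -> connect (adj B') x y.
Proof.
move=> /subsetP sBB'; apply: connect_sub x y => x y /existsP[e /andP[eB /eqP exy]].
by apply/connect1/(ends_adj (sBB' _ eB)).
Qed.

(** The condition on the ends in [es] carries the induction: the first edge has end [x], which is
    not on the rest of the path, so it differs from all later edges. *)
Lemma path_edges B x p :
  path (adj B) x p -> uniq (x :: p) ->
  exists es, [/\ uniq es, all (mem B) es, {in es, forall e, {subset ends e <= x :: p}}
    & map (@ends G) es = [seq [set q.1; q.2] | q <- zip (belast x p) p]].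
Proof.
elim: p x => [|y p IHp] x; first by exists [::].
case/andP=> /existsP[e /andP[eB /eqP exy]] pth /andP[xNp unp].
have [es [ues esB esp eqes]] := IHp y pth unp.
exists (e :: es); split=> /=; last by rewrite exy eqes.
- rewrite ues andbT; apply: contra xNp => /esp -> //.
  by rewrite exy set21.
- by rewrite eB.
move=> f; rewrite inE => /predU1P[->|fes] z.
  by rewrite exy !inE => /orP[] ->; rewrite ?orbT.
by move/(esp f fes) => zp; rewrite inE zp orbT.
Qed.

(** A simple path from [u] to [v] avoiding [f] would be closed by [f] to a cycle. *)
Lemma acyclic_not_connect B f u v :
  is_acyclic B -> f \in B -> ends f = [set u; v] ->
  ~~ connect (adj (B :\ f)) u v.
Proof.
move=> acB fB fuv; apply/negP => /connectP[p0 pth0 v_last].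
have := ends_card f; rewrite fuv cards2; have [_ //|neq_uv _] := eqVneq u v.
case/shortenP: pth0 v_last => p pth up _ v_last.
have [es [ues esB _ eqes]] := path_edges pth up.
have /(is_acyclicP _)/(_ (u :: p) (rcons es f)) := acB; apply/negP/negPn.
apply/and5P; split=> //.
- rewrite rcons_uniq ues andbT; apply/negP => /(allP esB).
  by rewrite /= setD11.
- rewrite all_rcons /= fB; apply: sub_all esB => e.
  by rewrite /= in_setD1 => /andP[].
(* The rotation moves [u] to the end, so the last pair joins the end [v] of the path to [u], which
   matches [f]. *)
rewrite rot1_cons map_rcons eqes fuv v_last [u :: p]lastI zip_rcons.
  by rewrite map_rcons /= setUC.
by rewrite size_belast.
Qed.

(** Induction on the walk: a last step other than [f] prolongs the current segment, while a step
    along [f] changes the case. One crossing of [f] at most is recorded, since crossing back returns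
    to an end already reached. *)
Lemma connect_adjD1 B f u v x y :
  f \in B -> ends f = [set u; v] -> connect (adj B) x y ->
  let B' := B :\ f in
  [\/ connect (adj B') x y,
      connect (adj B') x u /\ connect (adj B') v y
    | connect (adj B') x v /\ connect (adj B') u y].
Proof.
move=> fB fuv /connectP[p pth ->] B'.
elim/last_ind: p pth => [_ | p z IHp]; first by constructor 1.
rewrite rcons_path last_rcons => /andP[/IHp {}IHp /existsP[e /andP[eB /eqP exy]]].
have [ef | neq_ef] := eqVneq e f; last first.
  have ez : connect (adj B') (last x p) z.
    by apply/connect1/(ends_adj _ exy); rewrite in_setD1 neq_ef.
  case: IHp => [c|[c1 c2]|[c1 c2]].
  - by constructor 1; apply: connect_trans ez.
  - by constructor 2; split=> //; apply: connect_trans ez.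
  - by constructor 3; split=> //; apply: connect_trans ez.
have neq_uv : u != v by have := ends_card f; rewrite fuv cards2; case: eqP.
have neq_lz : last x p != z by have := ends_card e; rewrite exy cards2; case: eqP.
move: exy; rewrite ef fuv => exy.
have := set21 (last x p) z; rewrite -exy => /set2P el.
have := set22 (last x p) z; rewrite -exy => /set2P ez.
case: el ez IHp neq_lz => -> [] ->; rewrite ?eqxx // => IHp _.
- case: IHp => [c|[c1 c2]|[c1 c2]].
  + by constructor 2.
  + by constructor 2.
  + by constructor 1.
- case: IHp => [c|[c1 c2]|[c1 c2]].
  + by constructor 3.
  + by constructor 1.
  + by constructor 3.
Qed.

Lemma is_acyclicS B B' : B \subset B' -> is_acyclic B' -> is_acyclic B.
Proof.
move=> /subsetP sBB' /is_acyclicP acB'; apply/is_acyclicP => vs es.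
apply: contra (acB' vs es) => /and5P[vs0 uvs ues esB eqes].
by apply/and5P; split=> //; apply: sub_all esB => e; apply: sBB'.
Qed.

(* Deleting the edge f = uv splits one component; its representative r stays on
   one side, and the end of f on the other side becomes the representative of
   the new component. *)
Lemma card_forest B R :
  is_acyclic B -> (forall x, exists2 r, r \in R & connect (adj B) r x) ->
  {in R &, forall r s, connect (adj B) r s -> r = s} ->
  (#|R| + #|B| = #|vertex G|)%N.
Proof.
move Dn: #|B| => n; elim: n B R Dn => [|n IHn] B R Dn acB covR indR.
  have B0 : B = set0 by apply/eqP; rewrite -cards_eq0 Dn.
  rewrite addn0 -cardsT; congr #|pred_of_set _|; apply/setP => x; rewrite inE.
  have [r rR] := covR x; case/connectP => -[_ -> // | y p].
  by case/andP=> /existsP[e]; rewrite B0 inE.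
have /set0Pn[f fB] : B != set0 by rewrite -cards_eq0 Dn.
have sD := subsetDl B [set f].
have /eqP/cards2P[u0 [v0 [neq0 fuv0]]] := ends_card f.
have [r [u [v [rR fuv cru]]]] : exists r, exists u, exists v,
    [/\ r \in R, ends f = [set u; v] & connect (adj (B :\ f)) r u].
  have [r rR cru0] := covR u0; exists r.
  case: (connect_adjD1 fB fuv0 cru0) => [c|[c1 c2]|[c1 c2]].
  - by exists u0, v0.
  - by exists u0, v0.
  - by exists v0, u0; split=> //; rewrite setUC.
have Nuv := acyclic_not_connect acB fB fuv.
have crv : connect (adj B) r v.
  apply: connect_trans (connect_adjS sD cru) _.
  exact/connect1/(ends_adj fB).
(* Among the representatives only [r] reaches [v] in [B]; reaching it without [f] would connect [u]
   to [v] in [B :\ f]. *)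
have RNv s : s \in R -> ~~ connect (adj (B :\ f)) s v.
  move=> sR; apply/negP => csv; case/negP: Nuv.
  have rs : r = s.
    apply: indR => //; apply: connect_trans crv _.
    by rewrite connect_adj_sym; apply: connect_adjS sD csv.
  by apply: connect_trans csv; rewrite connect_adj_sym -rs.
have vNR : v \notin R by apply: (contraTN (@RNv v)); rewrite connect0.
have Dn' : #|B :\ f| = n.
  by apply: succn_inj; rewrite -Dn [in RHS](cardsD1 f) fB.
rewrite -(IHn _ (v |: R) Dn').
- by rewrite cardsU1 vNR addnS.
- exact: is_acyclicS acB.
- move=> x; have [s sR csx] := covR x.
  case: (connect_adjD1 fB fuv csx) => [c|[c1 c2]|[c1 c2]].
  + by exists s => //; rewrite setU1r.
  + by exists v => //; rewrite setU11.
  + by case/negP: (RNv s sR).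
move=> s t /setU1P[->|sR] /setU1P[->|tR] //.
- by rewrite connect_adj_sym => c; case/negP: (RNv t tR).
- by move=> c; case/negP: (RNv s sR).
by move/(connect_adjS sD); apply: indR.
Qed.

(** In the forest on all vertices with edge set [B], the set [A] is one component, represented by
    [a], and each vertex outside [A] is isolated; [card_forest] counts these components. *)
Lemma card_tree A B : is_subgraph A B -> is_tree A B -> #|A| = #|B|.+1.
Proof.
move=> sAB /and3P[/set0Pn[a aA] /forall_inP cAB acB].
have outA x y : x \notin A -> connect (adj B) x y -> x = y.
  move=> xNA /connectP[[_ -> // | z p]].
  case/andP=> /existsP[e /andP[eB /eqP exz]] _ _; case/negP: xNA.
  by have /forall_inP/(_ e eB)/subsetP := sAB; apply; rewrite exz set21.
have := @card_forest B (a |: ~: A) acB.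
rewrite cardsU1 !inE aA /= => cardV.
have /eqP : (1 + #|~: A| + #|B| = #|A| + #|~: A|)%N.
  rewrite cardV ?cardsC //.
    move=> x; have [xA|xNA] := boolP (x \in A); last first.
      by exists x; rewrite // !inE xNA orbT.
    by exists a; [rewrite setU11 | exact: (forall_inP (cAB a aA))].
  move=> x y; rewrite !inE => /predU1P[->|xNA] /predU1P[->|yNA] //.
  - by rewrite connect_adj_sym => /outA ->.
  - by move/outA ->.
  - by move/outA ->.
by rewrite addnAC eqn_add2r add1n eq_sym => /eqP.
Qed.

(** * Small subtrees and parallel edges *)

Lemma vertex_subtree x : ([set x], set0) \in subtrees G.
Proof.
rewrite inE /is_tree; apply/and4P; split=> /=.
- by apply/forall_inP => e; rewrite inE.
- by apply/set0Pn; exists x; rewrite set11.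
- by apply/forall_inP => y /set1P->; apply/forall_inP => z /set1P->.
apply/is_acyclicP => [[|v vs] [|e es]]; apply/negP => /and5P[] //.
  by case: vs.
by move=> _ _ _ /andP[]; rewrite /= inE.
Qed.

Lemma subtrees_gt0 (x : vertex G) : 0 < #|subtrees G|%:R :> rat.
Proof.
by rewrite ltr0n; apply/card_gt0P; exists ([set x], set0); apply: vertex_subtree.
Qed.

Lemma edge_subtree f : (ends f, [set f]) \in subtrees G.
Proof.
rewrite inE /is_tree; apply/and4P; split=> /=.
- by apply/forall_inP => e /set1P->.
- by rewrite -cards_eq0 ends_card.
- have /eqP/cards2P[u [v [_ fuv]]] := ends_card f.
  have cuv : connect (adj [set f]) u v by apply/connect1/(ends_adj _ fuv)/set11.
  rewrite fuv; apply/forall_inP => y /set2P[]->; apply/forall_inP => z /set2P[]-> //.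
  by rewrite connect_adj_sym.
apply/is_acyclicP => vs es; apply/negP => /and5P[vs0 _ ues /allP esf /eqP eqes].
have size_es : size es = size vs.
  by rewrite -(size_map (@ends G)) eqes size_map size_zip size_rot minnn.
(* A cycle in [[set f]] has length one, so its edge would be a loop. *)
have : (size es <= size [:: f])%N.
  by apply: uniq_leq_size => // e /esf; rewrite /= !inE.
case: vs es vs0 size_es eqes {ues esf} => [|v [|w vs]] [|e [|e' es]] //= _ _ [eqe].
by have := ends_card e; rewrite eqe setUid cards1.
Qed.

Lemma parallel_not_acyclic B e f :
  e \in B -> f \in B -> e != f -> ends e = ends f -> ~~ is_acyclic B.
Proof.
move=> eB fB neq_ef eqef.
have /eqP/cards2P[u [v [neq_uv fuv]]] := ends_card f.
apply/negP => /is_acyclicP/(_ [:: u; v] [:: e; f])/negP; apply.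
apply/and5P; split; rewrite //= ?inE ?neq_uv ?neq_ef ?eB ?fB //.
by rewrite eqef fuv [[set v; u]]setUC.
Qed.

(** * Comparing means through sums of deviations *)

Lemma mean_subtree_orderE :
  mean_subtree_order G =
  (\sum_(T in subtrees G) #|T.1|%:R) / #|subtrees G|%:R.
Proof.
rewrite /mean_subtree_order /subtree_poly raddf_sum !horner_sum; congr (_ / _).
  by apply: eq_bigr => T _; rewrite /= derivXn hornerMn hornerXn expr1n.
rewrite -sumr_const; apply: eq_bigr => T _.
by rewrite hornerXn expr1n.
Qed.

Lemma sum_order_sub c :
  \sum_(T in subtrees G) (#|T.1|%:R - c) =
  (\sum_(T in subtrees G) #|T.1|%:R) - #|subtrees G|%:R * c :> rat.
Proof. by rewrite big_split /= sumr_const mulr_natl mulNrn. Qed.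

Lemma lt_mean_subtree_order c (x : vertex G) :
  (c < mean_subtree_order G) = (0 < \sum_(T in subtrees G) (#|T.1|%:R - c)).
Proof.
have N0 := subtrees_gt0 x.
by rewrite mean_subtree_orderE ltr_pdivlMr // sum_order_sub subr_gt0 mulrC.
Qed.

Lemma sum_order_sub_mean (x : vertex G) :
  \sum_(T in subtrees G) (#|T.1|%:R - mean_subtree_order G) = 0.
Proof.
have N0 := lt0r_neq0 (subtrees_gt0 x).
by rewrite sum_order_sub mean_subtree_orderE mulrC divfK ?subrr.
Qed.

Lemma exists_edge_sum_gt0 (f0 : edge G) :
  exists f : edge G, 0 <
    \sum_(T in subtrees G | f \in T.2) (#|T.1|%:R - mean_subtree_order G).
Proof.
set mu := mean_subtree_order G.
apply/existsP; apply: contraT => /existsPn le0.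
have /eqP/cards2P[u [v [_ fuv]]] := ends_card f0.
have : \sum_f \sum_(T in subtrees G | f \in T.2) (#|T.1|%:R - mu) <= 0.
  by apply: sumr_le0 => f _; rewrite leNgt le0.
rewrite (exchange_big_dep (mem (subtrees G))) /=; last by move=> i j _ /andP[].
rewrite leNgt => /negP[].
have -> : \sum_(T in subtrees G) \sum_(f | (T \in subtrees G) && (f \in T.2))
    (#|T.1|%:R - mu) = \sum_(T in subtrees G) (#|T.1|%:R - mu) ^+ 2.
  (* Adding this zero to the sum of squares turns each [(n - mu) ^+ 2] into [(n - 1) * (n - mu)],
     where [n - 1] is the number of edges of the subtree. *)
  have e0 : (mu - 1) * \sum_(T in subtrees G) (#|T.1|%:R - mu) = 0.
    by rewrite (sum_order_sub_mean u) mulr0.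
  rewrite -[RHS]addr0 -[X in _ = _ + X]e0 mulr_sumr -big_split; apply: eq_bigr => -[A B] TG /=.
  have /andP[/card_tree/[apply] /= -> ] : is_subgraph A B && is_tree A B.
    by move: TG; rewrite inE.
  under eq_bigl do rewrite TG.
  by rewrite sumr_const -[LHS]mulr_natl -addn1 natrD -/mu; ring.
have sq_ge0 (T : {set vertex G} * {set edge G}) : T \in subtrees G ->
  0 <= (#|T.1|%:R - mu) ^+ 2 by rewrite sqr_ge0.
rewrite lt_neqAle sumr_ge0 // andbT eq_sym psumr_neq0 //.
(* Some subtree has order different from [mu]: a single edge if [mu = 1], a single vertex
   otherwise. *)
have [mu1|neq_mu1] := eqVneq mu 1; apply/hasP.
  exists (ends f0, [set f0]); first by rewrite mem_index_enum.
  by rewrite edge_subtree ends_card mu1.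
exists ([set u], set0); first by rewrite mem_index_enum.
by rewrite vertex_subtree cards1 /= exprn_even_gt0 //= subr_eq0 eq_sym.
Qed.

End Forests.

(** * Subtrees that avoid or use the new edge *)

Section AddEdge.

Variables (G : multigraph) (u v : vertex G) (neq_uv : u != v).
Let H : multigraph := add_edge neq_uv.

Section Embedding.

Variable phi : edge G -> edge H.
Hypothesis phi_inj : injective phi.
Hypothesis ends_phi : forall e, @ends H (phi e) = @ends G e.

(** As [phi] preserves ends, adjacency is unchanged, and cycles transfer both ways. It is applied to
    [Some] and to the map that replaces an edge by the new one parallel to it. *)
Lemma subtree_imset (A : {set vertex G}) (B : {set edge G}) :
  ((A : {set vertex H}, phi @: B) \in subtrees H) = ((A, B) \in subtrees G).
Proof.
rewrite !inE /is_tree /=; congr [&& _, _, _ & _].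
- apply/forall_inP/forall_inP => sAB e.
    by move=> eB; rewrite -ends_phi; apply/sAB/imset_f.
  by case/imsetP=> e' e'B ->; rewrite ends_phi; apply: sAB.
- have eq_adj : @adj H (phi @: B) =2 @adj G B.
    move=> x y; apply/existsP/existsP => -[e /andP[eB exy]].
      case/imsetP: eB exy => e' e'B ->; rewrite ends_phi => exy.
      by exists e'; rewrite e'B.
    by exists (phi e); rewrite imset_f // ends_phi.
  apply: eq_forallb_in => x _; apply: eq_forallb_in => y _.
  exact: eq_connect.
apply/is_acyclicP/is_acyclicP => acB vs es; apply/negP => /and5P[vs0 uvs ues esB eqes].
  apply/negP: (acB vs (map phi es)); apply/negPn/and5P; split=> //.
  - by rewrite map_inj_uniq.
  - by rewrite all_map; apply: sub_all esB => e eB /=; apply: imset_f.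
  - by rewrite -map_comp (eq_map ends_phi).
have [es' Des'] : exists es', es = map phi es'.
  elim: es esB {ues eqes} => [|e es IHes] /=; first by exists [::].
  case/andP=> /imsetP[e' _ ->] /IHes[es' ->].
  by exists (e' :: es').
apply/negP: (acB vs es'); apply/negPn; move: ues esB eqes; rewrite Des'.
rewrite map_inj_uniq // all_map -map_comp (eq_map ends_phi) => ues esB eqes.
by apply/and5P; split=> //; apply: sub_all esB => e /=; rewrite mem_imset.
Qed.

(** Reindexing along [h]: the codomain hypothesis gives surjectivity, as [B] is then the image of
    its preimage under [phi]. *)
Lemma sum_subtree_imset (P : pred {set edge G}) (Q : pred {set edge H})
    (F : {set vertex G} -> rat) :
  (forall A (B : {set edge H}), (A, B) \in subtrees H -> Q B ->
     {subset B <= codom phi}) ->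
  (forall B : {set edge G}, Q (phi @: B) = P B) ->
  \sum_(T in subtrees H | Q T.2) F T.1 = \sum_(T in subtrees G | P T.2) F T.1.
Proof.
move=> codomQ QP.
pose h (T : {set vertex G} * {set edge G}) : {set vertex H} * {set edge H} :=
  (T.1, phi @: T.2).
have h_inj : injective h.
  by move=> [A B] [A' B'] [-> /(imset_inj phi_inj) ->].
transitivity (\sum_(T in h @: [set T in subtrees G | P T.2]) F T.1).
  apply: eq_bigl => -[A B] /=; apply/andP/imsetP => [[TH QB] | [[A' B'] + [-> ->]]].
    have DB : B = phi @: (phi @^-1: B).
      apply/setP => e; apply/idP/imsetP => [eB | [e' + ->]]; last by rewrite inE.
      by have /codomP[e' De] := codomQ A B TH QB e eB; exists e'; rewrite // inE -De.
    exists (A, phi @^-1: B); last by rewrite /h -DB.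
    by rewrite inE -subtree_imset -DB TH /= -QP -DB.
  by rewrite inE subtree_imset QP => /andP.
by rewrite big_imset /=; [apply: eq_bigl => T; rewrite inE | move=> ? ? _ _ /h_inj].
Qed.

End Embedding.

Lemma sum_add_edge (F : {set vertex G} -> rat) :
  \sum_(T in subtrees H) F T.1 =
  \sum_(T in subtrees G) F T.1 + \sum_(T in subtrees H | None \in T.2) F T.1.
Proof.
rewrite (bigID (fun T : {set vertex H} * {set edge H} => None \in T.2)) addrC; congr (_ + _).
rewrite (@sum_subtree_imset Some _ _ predT (fun B => None \notin B)) //.
- by apply: eq_bigl => T; rewrite andbT.
- exact: Some_inj.
- move=> A B _ NB [e|] eB; last by rewrite eB in NB.
  by rewrite codom_f.
by move=> B; apply/imsetP => -[].
Qed.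

(** Exchange [f] for the new edge. A subtree using the new edge cannot also use the parallel
    [Some f], so it lies in the image of the exchange. *)
Lemma sum_add_parallel_edge (f : edge G) (F : {set vertex G} -> rat) :
  ends f = [set u; v] ->
  \sum_(T in subtrees H | None \in T.2) F T.1 =
  \sum_(T in subtrees G | f \in T.2) F T.1.
Proof.
move=> fuv; pose phi e : edge H := if e == f then None else Some e.
have phi_inj : injective phi.
  by move=> e e'; rewrite /phi; do 2!case: eqP => [->|_] //; case.
have ends_phi e : ends (phi e) = ends e by rewrite /phi; case: eqP => [->|].
apply: (sum_subtree_imset phi_inj ends_phi (P := fun B => f \in B)
  (Q := fun B => None \in B)).
- move=> A B; rewrite inE => /and4P[_ _ _ acB] NB [e|] eB; apply/codomP.
    exists e; rewrite /phi; case: eqP => // ef; move: acB; apply: contraTeq => _.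
    by apply: (@parallel_not_acyclic H B (Some e) None) => //=; rewrite ef.
  by exists f; rewrite /phi eqxx.
move=> B; have -> : None = phi f by rewrite /phi eqxx.
by rewrite mem_imset.
Qed.

(** The subtrees of [G] deviate from their own mean by zero in total, so only those using the new
    edge matter. *)
Lemma lt_mean_add_edge :
  (mean_subtree_order G < mean_subtree_order H) =
  (0 < \sum_(T in subtrees H | None \in T.2) (#|T.1|%:R - mean_subtree_order G)).
Proof.
rewrite (@lt_mean_subtree_order H _ u).
by rewrite (sum_add_edge (fun A => #|A|%:R - _)) (sum_order_sub_mean u) add0r.
Qed.

(** All subtrees of [G] are single vertices, whereas those using the new edge have order at least
    two, and the new edge alone is one of them. *)
Lemma lt_mean_add_edge_edgeless :
  (edge G -> False) -> mean_subtree_order G < mean_subtree_order H.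
Proof.
move=> noE.
have mu1 : mean_subtree_order G = 1.
  have N0 := lt0r_neq0 (subtrees_gt0 u).
  rewrite mean_subtree_orderE -[X in _ / X]sumr_const.
  rewrite (eq_bigr (fun=> 1)) ?sumr_const ?divff // => -[A B].
  rewrite inE => /andP[/card_tree/[apply] /= ->].
  have -> : B = set0 by apply/setP => e; case: (noE e).
  by rewrite cards0.
rewrite lt_mean_add_edge mu1.
have ge2 (T : {set vertex H} * {set edge H}) :
    (T \in subtrees H) && (None \in T.2) -> 0 < #|T.1|%:R - 1 :> rat.
  case: T => A B /andP[]; rewrite inE => /andP[sAB tAB] /= NB.
  rewrite subr_gt0 ltr1n (card_tree sAB tAB) ltnS.
  by apply/card_gt0P; exists None.
rewrite lt_neqAle sumr_ge0 ?andbT; last by move=> T /ge2/ltW.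
rewrite eq_sym psumr_neq0; last by move=> T /ge2/ltW.
apply/hasP; exists (@ends H None, [set None]); first by rewrite mem_index_enum.
have T0 : ((@ends H None, [set None]) \in subtrees H) && (None \in [set None : edge H]).
  by rewrite edge_subtree set11.
by rewrite T0; apply: ge2 T0.
Qed.

End AddEdge.

Theorem proposition4p3 (G : multigraph) (order_ge2 : (2 <= #|vertex G|)%N) :
  exists (u v : vertex G) (neq_uv : u != v),
    mean_subtree_order G < mean_subtree_order (add_edge neq_uv).
Proof.
have [f0 _ | noE] := pickP (@predT (edge G)); last first.
  have /card_gt1P[u [v [_ _ neq_uv]]] := order_ge2.
  exists u, v, neq_uv; apply: lt_mean_add_edge_edgeless => e.
  by have := noE e.
have [f pos_f] := exists_edge_sum_gt0 f0.
(* The new edge is placed parallel to [f], whose subtrees have positive total deviation. *)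
have /eqP/cards2P[u [v [neq_uv fuv]]] := ends_card f.
exists u, v, neq_uv; rewrite lt_mean_add_edge.
by rewrite (sum_add_parallel_edge _ (fun A => #|A|%:R - _) fuv).
Qed.
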